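(* Let $K$ be a simplicial complex with a covering $K=K_1\cup\cdots\cup K_r$ by subcomplexes, and suppose that the symmetric group $\Sigma_r$ acts simplicially on $K$ by permuting $K_1,\ldots,K_r$, i.e. $g(K_i)=K_{g(i)}$ for all $g\in\Sigma_r$ and $i\in\{1,\ldots,r\}$. Let $N(K)$ be the nerve of this covering, with the induced $\Sigma_r$-action, and let $\Delta(P(N(K)))$ be its barycentric subdivision. Then there is a $\Sigma_r$-map (i.e. a $\Sigma_r$-equivariant continuous map) \[ K\to\Delta(P(N(K))). \]
   Context: The nerve $N(K)$ is the simplicial complex whose simplices are the non-empty subsets $I\subset\{1,\ldots,r\}$ with $\bigcap_{i\in I}K_i\neq\emptyset$; $\Sigma_r$ acts on it by $I\mapsto g(I)$. For a simplicial complex $L$, $P(L)$ denotes its face poset (non-empty simplices ordered by inclusion), and for a poset $Q$, $\Delta(Q)$ denotes the order complex of $Q$ (the simplicial complex of finite non-empty chains); so $\Delta(P(L))$ is the barycentric subdivision of $L$. Simplicial complexes are identified with their geometric realizations. *)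

(* Defs.v *)
From HB Require Import structures.
From mathcomp Require Import all_boot all_order all_algebra all_fingroup.
From mathcomp Require Import finmap.
From mathcomp Require Import all_classical all_reals all_analysis.
Import numFieldNormedType.Exports.

Set Implicit Arguments.
Unset Strict Implicit.
Unset Printing Implicit Defensive.

Import Order.TTheory GRing.Theory Num.Theory.
Local Open Scope fset_scope.
Local Open Scope classical_set_scope.
Local Open Scope ring_scope.

(* The vertices of K are the v : V such that [fset v] is a face: not every
   element of V has to be a vertex.  The empty set is not a face, and K may be
   infinite. *)
Record simplicial_complex (V : choiceType) := SimplicialComplex {
  faces : set {fset V};
  face_neq0 : forall s, faces s -> s != fset0;
  face_sub : forall s t, faces s -> (t `<=` s)%fset -> t != fset0 -> faces t
}.

Definition simplicial_map (V W : choiceType) (K : simplicial_complex V)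
    (L : simplicial_complex W) (f : V -> W) : Prop :=
  forall s, faces K s -> faces L [fset f v | v in s]%fset.

Section nerve.
Variables (V : choiceType) (r : nat) (Ki : 'I_r -> simplicial_complex V).

Definition nerve_faces : set {fset 'I_r} :=
  [set I | I != fset0 /\ \bigcap_(i in [set` I]) faces (Ki i) !=set0].

Lemma nerve_neq0 I : nerve_faces I -> I != fset0.
Proof. by case. Qed.

Lemma nerve_sub I J :
  nerve_faces I -> (J `<=` I)%fset -> J != fset0 -> nerve_faces J.
Proof.
move=> [_ [s sI]] /fsubsetP JI J0; split => //; exists s => i /= iJ.
exact/sI/JI.
Qed.

Definition nerve := SimplicialComplex nerve_neq0 nerve_sub.

End nerve.

Definition face_poset (V : choiceType) (K : simplicial_complex V) :=
  set_type (faces K).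

Section face_poset.
Variables (V : choiceType) (K : simplicial_complex V).

HB.instance Definition _ := SubChoice.on (face_poset K).

Definition face_le (s t : face_poset K) := (val s `<=` val t)%fset.

Lemma face_le_refl : reflexive face_le.
Proof. by move=> s; exact: fsubset_refl. Qed.

Lemma face_le_anti : antisymmetric face_le.
Proof.
by move=> s t st; apply/val_inj/eqP; rewrite eqEfsubset.
Qed.

Lemma face_le_trans : transitive face_le.
Proof. by move=> t s u; exact: fsubset_trans. Qed.

HB.instance Definition _ := Order.Le_isPOrder.Build (Order.Disp tt tt)
  (face_poset K) face_le_refl face_le_anti face_le_trans.

End face_poset.

Section order_complex.
Variables (d : Order.disp_t) (Q : porderType d).

Definition chains : set {fset Q} :=
  [set c | c != fset0 /\ {in c &, forall x y, (x >=< y)%O}].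

Lemma chain_neq0 c : chains c -> c != fset0.
Proof. by case. Qed.

Lemma chain_sub c b : chains c -> (b `<=` c)%fset -> b != fset0 -> chains b.
Proof.
move=> [_ cc] /fsubsetP bc b0; split => // x y xb yb.
by apply: cc; exact: bc.
Qed.

Definition order_complex := SimplicialComplex chain_neq0 chain_sub.

End order_complex.

Section realization.
Variables (R : realType) (V : choiceType) (K : simplicial_complex V).

(* barycentric coordinates *)
Definition bary_points : set (V -> R) :=
  [set x | [/\ forall v, 0 <= x v,
               \sum_(v \in [set: V]) x v = 1
             & exists2 s, faces K s & [set v | x v != 0] = [set` s]]].

Definition realization := set_type bary_points.

HB.instance Definition _ := SubChoice.on realization.

Definition closed_simplex (s : {fset V}) : set realization :=
  [set x | [set v | val x v != 0] `<=` [set` s]].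

(* The weak topology: a set is open iff its trace on every closed simplex is
   open for the Euclidean topology of that simplex, i.e. the one induced by
   the product topology of R^V. *)
Definition weak_open (U : set realization) : Prop :=
  forall s, faces K s -> exists2 O : set {ptws V -> R}, open O &
    closed_simplex s `&` U = closed_simplex s `&` (val @^-1` O).

Lemma weak_openT : weak_open setT.
Proof. by move=> s _; exists setT; [exact: openT|]. Qed.

Lemma weak_openI : setI_closed weak_open.
Proof.
move=> A B oA oB s Ks; have [OA oOA eA] := oA s Ks; have [OB oOB eB] := oB s Ks.
exists (OA `&` OB); first exact: openI.
by rewrite setIIr eA eB -setIIr preimage_setI.
Qed.

Lemma weak_open_bigU (I : Type) (f : I -> set realization) :
  (forall i, weak_open (f i)) -> weak_open (\bigcup_i f i).
Proof.
move=> of_ s Ks.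
have /choice[D DP] : forall i, exists O : set {ptws V -> R}, open O /\
    closed_simplex s `&` f i = closed_simplex s `&` (val @^-1` O).
  by move=> i; have [D ? ?] := of_ i s Ks; exists D.
exists (\bigcup_i D i); first by apply: bigcup_open => i _; case: (DP i).
rewrite preimage_bigcup !setI_bigcupr; apply: eq_bigcupr => i _.
by case: (DP i).
Qed.

HB.instance Definition _ := isOpenTopological.Build realization
  weak_openT weak_openI weak_open_bigU.

End realization.

Section realization_map.
Variables (R : realType).

Definition push (V W : choiceType) (f : V -> W) (x : V -> R) (w : W) : R :=
  \sum_(v \in f @^-1` [set w]) x v.

Section push_finite.
Variables (V W : choiceType) (f : V -> W) (x : V -> R) (s : {fset V}).
Hypothesis xs : [set v | x v != 0] = [set` s].

Lemma push_finE w : push f x w = \sum_(v <- s | f v == w) x v.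
Proof.
have -> : push f x w = \sum_(v \in [set` [pred v | f v == w]]) x v.
  by apply: eq_fsbigl; apply/seteqP; split => v /= /eqP.
rewrite -(bigfs _ (fset_uniq s)) // => v _; apply: contraNeq => xv.
by have : [set` s] v by rewrite -xs.
Qed.

Lemma sum_finE : \sum_(v \in [set: V]) x v = \sum_(v <- s) x v.
Proof.
rewrite -(fsbig_widen [set` s]) //; first by rewrite [RHS]fsbig_seq ?fset_uniq.
move=> v /= [_ vs]; apply: contra_notP vs => /eqP xv.
by have : [set` s] v by rewrite -xs.
Qed.

End push_finite.

Lemma supp_gt0 (V : choiceType) (x : V -> R) (s : {fset V}) v :
  (forall v, 0 <= x v) -> [set v | x v != 0] = [set` s] ->
  (0 < x v) = (v \in s).
Proof.
move=> x0 xs; rewrite lt_def x0 andbT; apply/idP/idP => [xv|vs].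
  by have : [set v | x v != 0] v by []; rewrite xs.
by have : [set` s] v by []; rewrite -xs.
Qed.

Variables (V W : choiceType).
Variables (K : simplicial_complex V) (L : simplicial_complex W).

Lemma push_bary (f : V -> W) (x : V -> R) : simplicial_map K L f ->
  bary_points K x -> bary_points L (push f x).
Proof.
move=> fKL [x0 x1 [s Ks xs]].
have p0 w : 0 <= push f x w by rewrite (push_finE f xs) sumr_ge0.
have supp : [set w | push f x w != 0] = [set` [fset f v | v in s]%fset].
  apply/seteqP; split => w /=.
    apply: contra_neqT => wfs; rewrite (push_finE f xs) big_seq_cond big1 //.
    move=> v /andP[vs /eqP fv]; case/negP: wfs.
    by apply/imfsetP; exists v.
  move=> /imfsetP[v /= vs ->]; rewrite (push_finE f xs) gt_eqF //.
  rewrite big_mkcond (big_fsetD1 v) //= eqxx ltr_wpDr //.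
    by rewrite sumr_ge0 // => u _; case: ifP.
  by rewrite (supp_gt0 v x0 xs).
split => //; last by exists [fset f v | v in s]%fset => //; exact: fKL.
rewrite (sum_finE supp) -x1 (sum_finE xs) (partition_big_imfset _ f).
by apply: eq_bigr => w _; rewrite (push_finE f xs).
Qed.

Definition realization_map (f : V -> W) (fKL : simplicial_map K L f)
    (x : realization R K) : realization R L :=
  exist _ (push f (val x)) (mem_set (push_bary fKL (set_mem (valP x)))).

End realization_map.

Section actions.
Variables (gT : finGroupType).

Record simplicial_action (V : choiceType) (K : simplicial_complex V) :=
  SimplicialAction {
    vertex_action :> {action gT &-> V};
    simplicial_actionP : forall g, simplicial_map K K (vertex_action^~ g)
  }.

Record poset_action (d : Order.disp_t) (Q : porderType d) := PosetAction {
  poset_act :> {action gT &-> Q};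
  poset_actionP : forall g, {homo poset_act^~ g : x y / (x <= y)%O}
}.

(* act1, actM, actK and actKV are only available in the library for finType *)
Section total_action.
Variables (T : Type) (to : {action gT &-> T}).

Lemma tactM x g h : to x (g * h)%g = to (to x g) h.
Proof. by case: to => /= ? [_]; apply; rewrite inE. Qed.

Lemma tact1 x : to x 1%g = x.
Proof.
have inj : injective (to^~ 1%g) by move=> y z; case: to => /= ? [inj _]; exact: inj.
by apply: inj; rewrite /= -tactM mulg1.
Qed.

Lemma tactK g : cancel (to^~ g) (to^~ g^-1%g).
Proof. by move=> x; rewrite -tactM mulgV tact1. Qed.

Lemma tactKV g : cancel (to^~ g^-1%g) (to^~ g).
Proof. by move=> x; rewrite -tactM mulVg tact1. Qed.

End total_action.

Section fset_action.
Variables (V : choiceType) (to : {action gT &-> V}).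

Definition fset_act (s : {fset V}) (g : gT) := [fset to v g | v in s]%fset.

Lemma fset_act1 s : fset_act s 1%g = s.
Proof.
apply/fsetP => v; apply/imfsetP/idP => [[u /= us ->]|vs].
  by rewrite tact1.
by exists v; rewrite ?tact1.
Qed.

Lemma fset_actM s g h : fset_act s (g * h)%g = fset_act (fset_act s g) h.
Proof.
apply/fsetP => v; apply/imfsetP/imfsetP => [[u /= us ->]|[w /imfsetP[u /= us ->] ->]].
  by exists (to u g); rewrite ?tactM //; apply/imfsetP; exists u.
by exists u; rewrite ?tactM.
Qed.

End fset_action.

Section face_action.
Variables (V : choiceType) (K : simplicial_complex V).
Variables (to : simplicial_action K).

Definition face_act (s : face_poset K) (g : gT) : face_poset K :=
  exist _ (fset_act to (val s) g)
    (mem_set (simplicial_actionP to g (set_mem (valP s)))).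

Lemma face_act1 s : face_act s 1%g = s.
Proof. by apply/val_inj; exact: fset_act1. Qed.

Lemma face_actM s : act_morph face_act s.
Proof. by move=> g h; apply/val_inj; exact: fset_actM. Qed.

Lemma face_act_homo g :
  {homo face_act^~ g : s t / (s <= t)%O}.
Proof. move=> s t /fsubsetP st; apply/fsubsetP => _ /imfsetP[v /= vs ->].
by apply/imfsetP; exists v => //; exact: st. Qed.

Definition face_action : poset_action (face_poset K) :=
  @PosetAction _ _ (TotalAction face_act1 face_actM) face_act_homo.

End face_action.

Section order_action.
Variables (d : Order.disp_t) (Q : porderType d) (to : poset_action Q).

Lemma order_action_simplicial g :
  simplicial_map (order_complex Q) (order_complex Q) (to^~ g).
Proof.
move=> c [c0 cc]; split.
  have [v vc] := fset0Pn _ c0.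
  by apply/fset0Pn; exists (to v g); apply/imfsetP; exists v.
move=> _ _ /imfsetP[u /= uc ->] /imfsetP[v /= vc ->].
have /orP[uv|vu] := cc _ _ uc vc; apply/orP; [left|right]; exact: poset_actionP.
Qed.

Definition order_action : simplicial_action (order_complex Q) :=
  SimplicialAction order_action_simplicial.

End order_action.

Section realization_action.
Variables (R : realType) (V : choiceType) (K : simplicial_complex V).
Variables (to : simplicial_action K).

Definition realization_act (x : realization R K) (g : gT) :=
  realization_map (simplicial_actionP to g) x.

Lemma push_actE (x : V -> R) g v : push (to^~ g) x v = x (to v g^-1%g).
Proof.
rewrite /push (_ : _ @^-1` _ = [set to v g^-1%g]) ?fsbig_set1 //.
apply/seteqP; split => u /=.
  by move=> <-; rewrite (tactK to g).
by move=> ->; rewrite (tactKV to g).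
Qed.

Lemma realization_act1 x : realization_act x 1%g = x.
Proof. by apply/val_inj/funext => v /=; rewrite push_actE invg1 tact1. Qed.

Lemma realization_actM x : act_morph realization_act x.
Proof.
by move=> g h; apply/val_inj/funext => v /=; rewrite !push_actE invMg tactM.
Qed.

Definition realization_action : {action gT &-> realization R K} :=
  TotalAction realization_act1 realization_actM.

End realization_action.

End actions.

Definition equivariant (gT : finGroupType) (X Y : Type)
    (toX : {action gT &-> X}) (toY : {action gT &-> Y}) (f : X -> Y) : Prop :=
  forall x g, f (toX x g) = toY (f x) g.

Section covering.
Variables (V : choiceType) (r : nat) (K : simplicial_complex V).

Definition covering (Ki : 'I_r -> simplicial_complex V) : Prop :=
  faces K = \bigcup_i faces (Ki i).

(* The product of 'S_r is (g * h) i = h (g i), the opposite of composition of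
   functions, so the left actions of the symmetric group are the actions of
   'S_r in the sense of {action _ &-> _}, written on the right. *)
Definition permutes (to : simplicial_action 'S_r K)
    (Ki : 'I_r -> simplicial_complex V) : Prop :=
  forall g i, [set fset_act to s g | s in faces (Ki i)] = faces (Ki (g i)).

Variables (to : simplicial_action 'S_r K) (Ki : 'I_r -> simplicial_complex V).
Hypothesis toKi : permutes to Ki.

Lemma nerve_action_simplicial (g : 'S_r) :
  simplicial_map (nerve Ki) (nerve Ki) (('P%act : {action 'S_r &-> 'I_r})^~ g).
Proof.
move=> I [I0 [s sI]]; split.
  have [i iI] := fset0Pn _ I0.
  by apply/fset0Pn; exists (g i); apply/imfsetP; exists i.
exists (fset_act to s g) => _ /= /imfsetP[i /= iI ->].
by rewrite apermE -toKi; exists s => //; exact: sI.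
Qed.

Definition nerve_action : simplicial_action 'S_r (nerve Ki) :=
  SimplicialAction nerve_action_simplicial.

End covering.

(* Main.v *)
(* Put a_i(x) = max_v x_v - max {x_v | {v} is not a face of K_i} >= 0.  If K_i
   contains the support of x then a_i(x) > 0; and if a_i(x) > 0 then every vertex
   at which x is maximal lies in K_i, so {i | a_i(x) > 0} is a simplex of the
   nerve.  The sets J such that a_i(x) > 0 and a_i(x) > a_j(x) for all i in J and
   j not in J form a chain of such simplices, and are detected by the continuous
   weights prod_(i in J) (a_i^+ * prod_(j notin J) (a_i - a_j)^+).  Normalised to
   sum 1, these weights are the barycentric coordinates of the image of x. *)

Require Import Defs.
From mathcomp Require Import all_boot all_order all_algebra all_fingroup.
From mathcomp Require Import finmap.
From mathcomp Require Import all_classical all_reals all_analysis.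
Import numFieldNormedType.Exports.

Set Implicit Arguments.
Unset Strict Implicit.
Unset Printing Implicit Defensive.

Import Order.TTheory GRing.Theory Num.Theory.
Local Open Scope fset_scope.
Local Open Scope classical_set_scope.
Local Open Scope ring_scope.

(** * Continuity out of and into the weak topology *)

(** Continuity of [F] is asked only at points of the closed simplex, so that [F] may be a quotient
    whose denominator vanishes elsewhere. *)
Lemma weak_continuous (R : realType) (V : choiceType)
    (K : simplicial_complex V) (T : topologicalType) (f : realization R K -> T) :
  (forall s, faces K s -> exists F : {ptws V -> R} -> T,
    forall x, closed_simplex s x ->
      {for (val x : {ptws V -> R}), continuous F} /\ F (val x) = f x) ->
  continuous f.
Proof.
move=> locf; apply/continuousP => U oU.
change (weak_open (f @^-1` U)) => s Ks; have [F FP] := locf s Ks.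
(* The preimage of [U] under [F] need not be open, but its interior has the same trace on the
   simplex. *)
exists (interior (F @^-1` U)); first exact: open_interior.
apply/seteqP; split=> x /= [sx]; have [Fc Fx] := FP x sx => fU; split=> //.
  by apply: Fc; rewrite Fx; exact: open_nbhs_nbhs.
by rewrite /preimage /= -Fx; exact: (interior_subset fU).
Qed.

Lemma ptws_continuous (R : realType) (W : choiceType) (X : topologicalType)
    (f : X -> {ptws W -> R}) :
  (forall w, continuous (fun x => f x w : R)) -> continuous f.
Proof.
move=> fw x; apply/cvg_sup => w.
by apply: (@continuous_comp_initial _ _ _ (fun h : W -> R => h w)); exact: fw.
Qed.

(** With finitely many vertices the weak topology is induced by the product topology: a weakly open
    set is cut out by finitely many open conditions, one per face. *)
Lemma val_continuous_finite (R : realType) (W : choiceType)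
    (L : simplicial_complex W) (X : topologicalType) (f : X -> realization R L) :
  finite_set [set: W] ->
  continuous (fun x => val (f x) : {ptws W -> R}) -> continuous f.
Proof.
move=> finW fc; apply/continuousP => U.
change (weak_open U -> open (f @^-1` U)) => oU.
have finL : finite_set (faces L).
  apply: (@sub_finite_set _ _ [set` fpowerset (fset_set [set: W])]) => // s _ /=.
  by rewrite fpowersetE; apply/fsubsetP => w _; rewrite in_fset_set// inE.
have /choice[D DP] : forall s, exists O : set {ptws W -> R}, open O /\
    (faces L s -> closed_simplex s `&` U = closed_simplex s `&` (val @^-1` O)).
  move=> s; have [/oU[B oB eB]|Ls] := pselect (faces L s); first by exists B.
  by exists setT; split=> //; exact: openT.
(* Points not supported in [s] are added, so that [E s] constrains only the closed simplex of
   [s]. *)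
pose E s := D s `|` \bigcup_(w in ~` [set` s]) [set y : {ptws W -> R} | y w != 0].
have oE s : open (E s).
  apply: openU; first by case: (DP s).
  apply: bigcup_open => w _.
  apply: (@open_comp _ _ (fun y : {ptws W -> R} => y w) [set t | t != 0]).
    by move=> y _; exact: (@proj_continuous W (fun=> R) w).
  exact: open_neq.
have -> : f @^-1` U = (fun x => val (f x)) @^-1` (\bigcap_(s in faces L) E s).
  apply/seteqP; split => x /=.
    move=> Ux s Ls.
    have [sx|/existsNP[w /not_implyP[xw sw]]] :=
      pselect (closed_simplex s (f x)).
      left; have [_ /(_ Ls) eqs] := DP s.
      have : (closed_simplex s `&` U) (f x) by split.
      by rewrite eqs => -[].
    by right; exists w.
  (* The support of [f x] is itself a face, and the condition of that face decides membership in
     [U]. *)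
  move=> Ex; have [_ _ [s Ls supp]] := set_mem (valP (f x)).
  have sx : closed_simplex s (f x) by rewrite /closed_simplex /= supp.
  have [Dx|[w sw xw]] := Ex s Ls; last first.
    by case: sw; rewrite -supp.
  have [_ /(_ Ls) eqs] := DP s.
  suff : (closed_simplex s `&` U) (f x) by case.
  by rewrite eqs.
move/continuousP: fc; apply.
rewrite -[X in open X]setCK setC_bigcap openC; apply: closed_bigcup => // s _.
by rewrite closedC.
Qed.

Lemma proj_ptws_continuous (R : realType) (V : choiceType) (v : V) :
  continuous (fun x : {ptws V -> R} => x v : R).
Proof. exact: (@proj_continuous V (fun=> R) v). Qed.

(** * Maxima of barycentric coordinates *)

Section max_on.
Variables (R : realType) (V : choiceType).
Implicit Types (P : set V) (x : V -> R) (s : {fset V}).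

(** A supremum, as [V] may be infinite; for empty [P] the default value of [sup] is 0, which suits
    nonnegative coordinates. *)
Definition max_on P x : R := sup [set x v | v in P].

(** Coordinates off [s] vanish, and the start value 0 of the fold accounts for them. *)
Lemma max_onE P s x : (forall v, 0 <= x v) -> [set v | x v != 0] `<=` [set` s] ->
  max_on P x = \big[Num.max/0]_(v <- s | v \in P) x v.
Proof.
move=> x0 xs; set m := \big[_/_]_(_ <- _ | _) _.
have m0 : 0 <= m by elim/big_ind: m => // a b a0 b0; rewrite le_max a0.
have ubm : ubound [set x v | v in P] m.
  move=> _ [v Pv <-]; have [->//|xv] := eqVneq (x v) 0.
  by apply: le_bigmax_seq; [exact: (xs v)|rewrite inE].
have hub : has_ubound [set x v | v in P] by exists m.
have max_ge0 : 0 <= max_on P x.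
  have [->|/set0P[v Pv]] := eqVneq P set0.
    by rewrite /max_on image_set0 sup0.
  by apply: le_trans (x0 v) _; apply: ub_le_sup => //; exists v.
apply/le_anti/andP; split; last first.
  apply: bigmax_le => // v; rewrite inE => Pv.
  by apply: ub_le_sup => //; exists v.
have [->|/set0P[v Pv]] := eqVneq P set0; first by rewrite /max_on image_set0 sup0.
by apply: ge_sup => //; exists (x v), v.
Qed.

Lemma bigmax_continuous P s :
  continuous (fun x : {ptws V -> R} => \big[Num.max/0]_(v <- s | v \in P) x v : R).
Proof.
apply: continuous_big => [|v _]; first exact: max_continuous.
exact: proj_ptws_continuous.
Qed.

End max_on.

(** * Weights that detect chains of index sets *)

Section chain_weight.
Variables (R : realType) (r : nat).
Implicit Types (a : 'I_r -> R) (J : {fset 'I_r}).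

Definition chain_weight a J : R := \prod_(i | i \in J)
  (Num.max 0 (a i) * \prod_(j | j \notin J) Num.max 0 (a i - a j)).

Lemma chain_weight_ge0 a J : 0 <= chain_weight a J.
Proof.
apply: prodr_ge0 => i _; rewrite mulr_ge0 ?le_max ?lexx //.
by apply: prodr_ge0 => j _; rewrite le_max lexx.
Qed.

Lemma chain_weight_neq0 a J : chain_weight a J != 0 <->
  (forall i, i \in J -> 0 < a i /\ forall j, j \notin J -> a j < a i).
Proof.
have max_neq0 (t : R) : (Num.max 0 t != 0) = (0 < t).
  by case: (ltP 0 t) => [t0|_]; [rewrite gt_eqF|rewrite eqxx].
split=> [/prodf_neq0 aJ i iJ|aJ].
  have := aJ i iJ; rewrite mulf_eq0 negb_or max_neq0 => /andP[-> /prodf_neq0 aij].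
  by split=> // j jJ; have := aij j jJ; rewrite max_neq0 subr_gt0.
apply/prodf_neq0 => i /aJ[ai aij]; rewrite mulf_neq0 ?max_neq0 //.
by apply/prodf_neq0 => j /aij; rewrite max_neq0 subr_gt0.
Qed.

(** Otherwise some [i] in [J] but not [J'] and some [j] in [J'] but not [J] would satisfy both
    [a j < a i] and [a i < a j]. *)
Lemma chain_weight_comparable a J J' : chain_weight a J != 0 ->
  chain_weight a J' != 0 -> (J `<=` J')%fset || (J' `<=` J)%fset.
Proof.
move=> /chain_weight_neq0 aJ /chain_weight_neq0 aJ'.
have [//|/fsubsetPn[i iJ iJ']] := boolP (J `<=` J')%fset.
apply/fsubsetP => j jJ'; apply: contraT => jJ.
have [_ /(_ j jJ) ji] := aJ i iJ; have [_ /(_ i iJ') ij] := aJ' j jJ'.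
by have := lt_trans ij ji; rewrite ltxx.
Qed.

Lemma chain_weight_continuous (X : topologicalType) (a : X -> 'I_r -> R) J :
  (forall i, continuous (a^~ i)) ->
  continuous (fun x => chain_weight (a x) J).
Proof.
have maxc (f : X -> R) : continuous f -> continuous (fun x => Num.max 0 (f x)).
  by move=> fc x; apply: (@continuous_max R X (fun=> 0)); [exact: cvg_cst|exact: fc].
move=> ac; apply: continuous_big => [|i _ x]; first exact: mul_continuous.
apply: cvgM; first exact: maxc.
apply: (continuous_big mul_continuous) => j _; apply: maxc => y.
by apply: cvgB; exact: ac.
Qed.

Lemma chain_weight_perm (g : 'S_r) a a' J : (forall i, a' (g i) = a i) ->
  chain_weight a' [fset g i | i in J]%fset = chain_weight a J.
Proof.
move=> a'g; have gJ i : (g i \in [fset g i | i in J]%fset) = (i \in J).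
  by apply/imfsetP/idP => [[k /= kJ /perm_inj->]|iJ] //; exists i.
rewrite /chain_weight (reindex_inj (@perm_inj _ g)); apply: eq_big => // i _.
rewrite a'g; congr (_ * _).
rewrite (reindex_inj (@perm_inj _ g)); apply: eq_big => [j|j _]; first by rewrite gJ.
by rewrite a'g.
Qed.

End chain_weight.

(** * Heights of a point relative to the members of the covering *)

Section cover_height.
Variables (R : realType) (V : choiceType) (r : nat).
Variables (K : simplicial_complex V) (Ki : 'I_r -> simplicial_complex V).

Definition cover_height (x : V -> R) (i : 'I_r) : R :=
  max_on setT x - max_on [set v | ~ faces (Ki i) [fset v]%fset] x.

Lemma cover_height_gt0 (x : V -> R) : covering K Ki -> bary_points K x ->
  exists i, 0 < cover_height x i.
Proof.
move=> cov [x0 x1 [s Ks supp]].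
have supps : [set v | x v != 0] `<=` [set` s] by rewrite supp.
have : (\bigcup_i faces (Ki i)) s by rewrite -cov.
case=> i _ Kis; exists i.
rewrite /cover_height !(max_onE _ x0 supps) [X in _ - X]big_seq_cond.
(* All vertices of the support lie in [Ki i], so the second maximum runs over no index and equals
   0. *)
rewrite [X in _ - X]big_pred0 ?subr0; last first.
  move=> v; apply/negP => /andP[vs]; rewrite inE; apply.
  apply: face_sub Kis _ _; first by rewrite fsub1set.
  by apply/fset0Pn; exists v; rewrite inE.
have [v vs] := fset0Pn _ (face_neq0 Ks).
apply: (@lt_le_trans _ _ (x v)); first by rewrite (supp_gt0 v x0 supp).
by apply: le_bigmax_seq => //; rewrite inE.
Qed.

(* Any vertex at which x is maximal will do. *)
Lemma cover_height_vertex (x : V -> R) : bary_points K x ->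
  exists v, forall i, 0 < cover_height x i -> faces (Ki i) [fset v]%fset.
Proof.
move=> [x0 x1 [s Ks supp]].
have supps : [set v | x v != 0] `<=` [set` s] by rewrite supp.
have [u us] := fset0Pn _ (face_neq0 Ks).
have [v maxv] : exists v, max_on setT x = x v.
  have : max_on setT x = 0 \/ exists v, max_on setT x = x v.
    rewrite (max_onE _ x0 supps).
    elim/big_ind : _ => [|a b Ha Hb|v _]; [by left| |by right; exists v].
    by case: (leP a b).
  (* If the fold returns its start value, the maximum is 0 and [u] attains it. *)
  case=> // m0; exists u; apply/eqP; rewrite eq_le {1}m0 x0 /=.
  rewrite (max_onE _ x0 supps).
  by apply: le_bigmax_seq => //; rewrite inE.
exists v => i; rewrite /cover_height maxv; apply: contraPP => Kiv.
apply/negP; rewrite -leNgt subr_le0 (max_onE _ x0 supps).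
have [->|xv] := eqVneq (x v) 0.
  by elim/big_ind : _ => // a b a0 b0; rewrite le_max a0.
by apply: le_bigmax_seq; [exact: supps|rewrite inE].
Qed.

(** On a closed simplex both suprema are maxima over the fixed finite set [s], which are continuous
    on all of R^V. *)
Lemma cover_height_closed_simplex (s : {fset V}) (i : 'I_r) :
  exists2 H : {ptws V -> R} -> R, continuous H &
    forall x : realization R K, closed_simplex s x -> H (val x) = cover_height (val x) i.
Proof.
pose b (P : set V) (x : {ptws V -> R}) : R := \big[Num.max/0]_(v <- s | v \in P) x v.
have bc P : continuous (b P) by exact: bigmax_continuous.
exists (fun x => b setT x - b [set v | ~ faces (Ki i) [fset v]%fset] x).
  by move=> x; apply: (@cvgB _ _ _ (nbhs x) _ (b setT)); exact: bc.
move=> x xs; have [x0 _ _] := set_mem (valP x).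
by rewrite /cover_height !(max_onE _ x0 xs).
Qed.

Variable to : simplicial_action 'S_r K.

Lemma fset_act_set1 (v : V) (g : 'S_r) :
  fset_act to [fset v]%fset g = [fset to v g]%fset.
Proof. exact: imfset_fset1. Qed.

Lemma permutes_vertex (v : V) (g : 'S_r) (i : 'I_r) : permutes to Ki ->
  faces (Ki (g i)) [fset to v g]%fset <-> faces (Ki i) [fset v]%fset.
Proof.
move=> toKi; rewrite -toKi; split => [[s Kis sv]|Kiv]; last first.
  by exists [fset v]%fset => //; exact: fset_act_set1.
(* Acting by the inverse of [g] recovers [s] from its image. *)
suff <- : s = [fset v]%fset by [].
by rewrite -(fset_act1 to s) -(mulgV g) fset_actM sv fset_act_set1 tactK.
Qed.

Lemma max_on_push (P : set V) (x : V -> R) (g : 'S_r) :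
  max_on P (push (to^~ g) x) = max_on ((to^~ g) @^-1` P) x.
Proof.
congr sup; apply/seteqP; split => _ [v /= Pv <-].
  by exists (to v g^-1%g); rewrite /= ?push_actE ?tactKV.
by exists (to v g); rewrite ?push_actE ?tactK.
Qed.

(** The action carries the vertices of [Ki i] onto those of [Ki (g i)], hence also the complements
    over which the second maximum is taken. *)
Lemma cover_height_push (x : V -> R) (g : 'S_r) (i : 'I_r) : permutes to Ki ->
  cover_height (push (to^~ g) x) (g i) = cover_height x i.
Proof.
move=> toKi; rewrite /cover_height !max_on_push preimage_setT.
congr (_ - max_on _ _); apply/seteqP.
by split=> v /=; apply: contra_not => /permutes_vertex; apply.
Qed.

End cover_height.

(** * The map to the subdivided nerve: well-definedness, continuity, equivariance *)

Section nerve_map.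
Variables (R : realType) (V : choiceType) (r : nat).
Variables (K : simplicial_complex V) (Ki : 'I_r -> simplicial_complex V).
Let W := face_poset (nerve Ki).

(** Even for infinite [K] this makes the total weight a finite sum and gives the target finitely
    many vertices. *)
Lemma finite_nerve : finite_set [set: W].
Proof.
have := @finite_preimage W _ setT val.
by apply; [move=> I J _ _ /val_inj|exact: finite_finset].
Qed.

Let weight (x : V -> R) (J : W) : R := chain_weight (cover_height Ki x) (val J).
Let total (x : V -> R) : R := \sum_(J \in [set: W]) weight x J.

Definition nerve_coord (x : V -> R) (J : W) : R := weight x J / total x.

(** One positive weight suffices, and the set of all indices of positive height has one: every index
    outside it has height at most 0. *)
Lemma nerve_total_gt0 (x : V -> R) : covering K Ki -> bary_points K x ->
  0 < total x.
Proof.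
move=> cov Kx; have [i hi] := cover_height_gt0 cov Kx.
have [v hv] := cover_height_vertex Ki Kx.
pose I := [fset j | j : 'I_r & 0 < cover_height Ki x j]%fset.
have inI j : (j \in I) = (0 < cover_height Ki x j) by rewrite !inE.
have NI : faces (nerve Ki) I.
  split; first by apply/fset0Pn; exists i; rewrite inI.
  by exists [fset v]%fset => j /=; rewrite inI; exact: hv.
pose J : W := exist _ I (mem_set NI).
have wJ : 0 < weight x J.
  rewrite lt_def chain_weight_ge0 andbT; apply/chain_weight_neq0 => j.
  rewrite inI => hj; split => // k; rewrite inI -leNgt => hk.
  exact: le_lt_trans hk hj.
rewrite /total fsbig_finite; last exact: finite_nerve.
rewrite (big_fsetD1 J) /=; last by rewrite in_fset_set ?inE //; exact: finite_nerve.
by rewrite ltr_wpDr // sumr_ge0 // => k _; exact: chain_weight_ge0.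
Qed.

(** The support is non-empty because the coordinates sum to 1, and a chain because sets of nonzero
    weight are comparable. *)
Lemma nerve_coord_bary (x : V -> R) : covering K Ki -> bary_points K x ->
  bary_points (order_complex W) (nerve_coord x).
Proof.
move=> cov Kx; have tx := nerve_total_gt0 cov Kx.
have sum1 : \sum_(J \in [set: W]) nerve_coord x J = 1.
  by rewrite -mulr_fsuml mulfV // gt_eqF.
have fin : finite_set [set J | nerve_coord x J != 0].
  by apply: sub_finite_set finite_nerve.
split=> //.
  by move=> J; rewrite divr_ge0 ?chain_weight_ge0 // ltW.
exists (fset_set [set J | nerve_coord x J != 0]); last by rewrite fset_setK.
split=> [|I J].
  apply: contraPneq sum1 => c0; rewrite fsbig1 => [|J _].
    by move=> /esym/eqP; rewrite oner_eq0.
  apply: contra_eq c0 => xJ; apply/fset0Pn; exists J.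
  by rewrite in_fset_set // inE.
have coord_neq0 H : nerve_coord x H != 0 -> weight x H != 0.
  by rewrite mulf_eq0 negb_or => /andP[].
rewrite !in_fset_set // => /set_mem/coord_neq0 xI /set_mem/coord_neq0 xJ.
exact: chain_weight_comparable xI xJ.
Qed.

Lemma nerve_coord_continuous (cov : covering K Ki) (J : W) :
  continuous (fun x : realization R K => nerve_coord (val x) J).
Proof.
apply: weak_continuous => s Ks.
have /choice[H HP] : forall i, exists H : {ptws V -> R} -> R, continuous H /\
    forall x : realization R K, closed_simplex s x ->
      H (val x) = cover_height Ki (val x) i.
  by move=> i; have [H Hc Hx] := cover_height_closed_simplex R K Ki s i; exists H.
pose w (I : W) (x : {ptws V -> R}) := chain_weight (H^~ x) (val I).
have wc I : continuous (w I).
  by apply: chain_weight_continuous => i; case: (HP i).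
pose t (x : {ptws V -> R}) := \sum_(I <- fset_set [set: W]) w I x.
have tc : continuous t.
  apply: continuous_big => [|I _]; [exact: add_continuous|exact: wc].
(* This quotient is known to be continuous only where [t] is nonzero, which includes the
   realization. *)
exists (fun x => w J x / t x) => x sx.
have hx : H^~ (val x) = cover_height Ki (val x).
  by apply/funext => i; case: (HP i) => _; apply.
have tE : t (val x) = total (val x).
  by rewrite /total fsbig_finite ?/t /w ?hx //; exact: finite_nerve.
split; last by rewrite /= tE /w hx.
apply: (@cvgM _ _ (nbhs (val x : {ptws V -> R})) _ (w J) (fun y => (t y)^-1)).
  exact: wc.
apply: (@cvgV _ _ (nbhs (val x : {ptws V -> R})) _ t); last exact: tc.
by rewrite tE gt_eqF // nerve_total_gt0 //; exact: set_mem (valP x).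
Qed.

Definition nerve_map (cov : covering K Ki) (x : realization R K) :
    realization R (order_complex W) :=
  exist _ (nerve_coord (val x))
    (mem_set (nerve_coord_bary cov (set_mem (valP x)))).

Lemma nerve_map_continuous (cov : covering K Ki) : continuous (nerve_map cov).
Proof.
apply: val_continuous_finite; first exact: finite_nerve.
by apply: ptws_continuous => J; exact: nerve_coord_continuous.
Qed.

Variable to : simplicial_action 'S_r K.

Lemma nerve_coord_push (toKi : permutes to Ki) (x : V -> R) (g : 'S_r) (J : W) :
  nerve_coord (push (to^~ g) x) (face_action (nerve_action toKi) J g) =
  nerve_coord x J.
Proof.
have wE I : weight (push (to^~ g) x) (face_action (nerve_action toKi) I g) =
    weight x I.
  by apply: chain_weight_perm => i; exact: cover_height_push.
rewrite /nerve_coord wE; congr (_ / _).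
rewrite /total (reindex_fsbigT (face_action (nerve_action toKi) ^~ g)).
  by apply: eq_fsbigr => I _; exact: wE.
exists (face_action (nerve_action toKi) ^~ g^-1%g); [exact: tactK|exact: tactKV].
Qed.

End nerve_map.

Theorem proposition3p4 (R : realType) (V : choiceType)
    (K : simplicial_complex V) (r : nat) (Ki : 'I_r -> simplicial_complex V)
    (Ki_cover : covering K Ki) (to : simplicial_action 'S_r K)
    (toKi : permutes to Ki) :
  exists phi : realization R K ->
      realization R (order_complex (face_poset (nerve Ki))),
    continuous phi /\
    equivariant (realization_action R to)
      (realization_action R (order_action (face_action (nerve_action toKi))))
      phi.
Proof.
exists (nerve_map Ki_cover); split; first exact: nerve_map_continuous.
move=> x g; apply/val_inj/funext => J.
pose to_nerve := face_action (nerve_action toKi).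
transitivity (nerve_coord (val x) (to_nerve J g^-1%g)); last first.
  exact/esym/(push_actE (order_action to_nerve)).
by rewrite -{1}[J](tactKV to_nerve g); exact: nerve_coord_push.
Qed.
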